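(* Let $X\subseteq\mathbb{R}^n$ be a subspace. Then the functions $\underline{\lambda}(X,\cdot),\overline{\lambda}(X,\cdot):\mathcal{LP}(\mathbb{I},\mathbb{R}^n)\to\mathbb{R}\cup\{-\infty,\infty\}$ are Lipschitz continuous with Lipschitz constant $1$ with respect to the metric $d_{\mathbb{I}}$ on $\mathcal{LP}(\mathbb{I},\mathbb{R}^n)$.
   Context: Let $n\ge 1$, let $|\cdot|$ be an arbitrary fixed norm on $\mathbb{R}^n$ with unit sphere $\mathcal{S}$ and induced operator norm $\|\cdot\|$. Let $\mathbb{I}\subset\mathbb{R}$ be compact (not necessarily an interval), $t_-=\min\mathbb{I}$, $t_+=\max\mathbb{I}$, $t_-<t_+$. Put $\mathbb{I}^2_{\neq}=\{(t,s)\in\mathbb{I}\times\mathbb{I}: t\neq s\}$ and let $\overline{\mathbb{I}^2_{\neq}}$ be its closure in $\mathbb{R}^2$. A linear process on $\mathbb{I}$ is a family $\Phi(t,s)\in GL(n,\mathbb{R})$, $t,s\in\mathbb{I}$, such that $(t,s,x)\mapsto\Phi(t,s)x$ is continuous, $\Phi(t,t)=\mathrm{id}$, $\Phi(t,s)\Phi(s,r)=\Phi(t,r)$ for all $t,s,r\in\mathbb{I}$, and $t\mapsto\Phi(t,s)$ is Lipschitz continuous in operator norm for every $s\in\mathbb{I}$. For continuous $f:\mathbb{I}\to(0,\infty)$ let $\Delta(f)(t,s)=\frac{\ln f(t)-\ln f(s)}{t-s}$, $(t,s)\in\mathbb{I}^2_{\neq}$. Standing assumption: $\mathcal{LP}(\mathbb{I},\mathbb{R}^n)$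 denotes the set of linear processes $\Phi$ on $\mathbb{I}$ for which $(x,t,s)\mapsto\Delta(|\Phi(\cdot,t_-)x|)(t,s)$ extends continuously from $\mathcal{S}\times\mathbb{I}^2_{\neq}$ to $\mathcal{S}\times\overline{\mathbb{I}^2_{\neq}}$; the extension is denoted by the same symbol. $\mathrm{Gr}(k,\mathbb{R}^n)$ is the set of $k$-dimensional subspaces of $\mathbb{R}^n$. For a subspace $X\neq\{0\}$, $\underline{\lambda}(X,\Phi)$ and $\overline{\lambda}(X,\Phi)$ are the minimum and the maximum, respectively, of $\Delta(|\Phi(\cdot,t_-)x|)(t,s)$ over $x\in X\cap\mathcal{S}$, $(t,s)\in\overline{\mathbb{I}^2_{\neq}}$; moreover $\underline{\lambda}(\{0\},\Phi)=\infty$ and $\overline{\lambda}(\{0\},\Phi)=-\infty$ for all $\Phi$ (these constant functions count as Lipschitz continuous). Metric: for $\Phi,\Psi\in\mathcal{LP}(\mathbb{I},\mathbb{R}^n)$, $$\tilde d_{\mathbb{I}}(\Phi,\Psi)=\sup_{X\in\mathrm{Gr}(1,\mathbb{R}^n)}\max\{|\underline{\lambda}(X,\Phi)-\underline{\lambda}(X,\Psi)|,|\overline{\lambda}(X,\Phi)-\overline{\lambda}(X,\Psi)|\},$$ $$d_{\mathbb{I}}(\Phi,\Psi)=\max\Big\{\sup_{x\in\mathcal{S}}\sup_{t\in\mathbb{I}}|(\Phi(t,t_-)-\Psi(t,t_-))x|,\ \tilde d_{\mathbb{I}}(\Phi,\Psi)\Big\}.$$ *)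

(* Defs.v *)
From HB Require Import structures.
From mathcomp Require Import all_boot all_order all_algebra.
From mathcomp Require Import all_classical all_reals all_analysis.

Set Implicit Arguments.
Unset Strict Implicit.
Unset Printing Implicit Defensive.
Import Order.TTheory GRing.Theory Num.Theory.
Import numFieldNormedType.Exports.
Local Open Scope classical_set_scope.
Local Open Scope ring_scope.

(* Least and greatest element; 0 is a junk value for sets that have none. *)
Definition minimum (R : realType) (A : set R) : R := xget 0 (A `&` lbound A).
Definition maximum (R : realType) (A : set R) : R := xget 0 (A `&` ubound A).

(* An arbitrary norm on R^n. It is an explicit function, not the library's
   norm on 'cV[R]_n, which is the max norm. Both induce the same topology. *)
Record is_norm (R : realType) (n : nat) (N : 'cV[R]_n -> R) : Prop := IsNorm {
  norm_triangle : forall x y, N (x + y) <= N x + N y ;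
  norm_homogeneous : forall (a : R) x, N (a *: x) = `|a| * N x ;
  norm_definite : forall x, N x = 0 -> x = 0 }.

Definition unit_sphere (R : realType) (n : nat) (N : 'cV[R]_n -> R) :
    set 'cV[R]_n :=
  [set x | N x = 1].

Definition op_norm (R : realType) (n : nat) (N : 'cV[R]_n -> R)
    (A : 'M[R]_n) : R :=
  sup [set N (A *m x) | x in unit_sphere N].

Definition off_diag (R : realType) (I : set R) : set (R * R) :=
  [set p | [/\ I p.1, I p.2 & p.1 != p.2]].

(* A process on I is a total function of (t, s); its values are only
   constrained, and only matter, for t and s in I. *)
Record is_linear_process (R : realType) (n : nat) (N : 'cV[R]_n -> R)
    (I : set R) (Phi : R -> R -> 'M[R]_n) : Prop := IsLinearProcess {
  process_unit : forall t s, I t -> I s -> Phi t s \in unitmx ;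
  process_continuous :
    {within I `*` I `*` [set: 'cV[R]_n],
      continuous (fun p : R * R * 'cV[R]_n => Phi p.1.1 p.1.2 *m p.2)} ;
  process_id : forall t, I t -> Phi t t = 1%:M ;
  process_comp : forall t s r, I t -> I s -> I r ->
    Phi t s *m Phi s r = Phi t r ;
  process_lipschitz : forall s, I s -> exists L : R, forall t t', I t -> I t' ->
    op_norm N (Phi t s - Phi t' s) <= L * `|t - t'| }.

Definition Delta (R : realType) (f : R -> R) (p : R * R) : R :=
  (ln (f p.1) - ln (f p.2)) / (p.1 - p.2).

Definition growth_rate (R : realType) (n : nat) (N : 'cV[R]_n -> R)
    (I : set R) (Phi : R -> R -> 'M[R]_n) (q : 'cV[R]_n * (R * R)) : R :=
  Delta (fun t => N (Phi t (minimum I) *m q.1)) q.2.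

Definition continuous_extensions (R : realType) (n : nat) (N : 'cV[R]_n -> R)
    (I : set R) (Phi : R -> R -> 'M[R]_n) : set ('cV[R]_n * (R * R) -> R) :=
  [set g | {within unit_sphere N `*` closure (off_diag I), continuous g} /\
    {in unit_sphere N `*` off_diag I, g =1 growth_rate N I Phi}].

(* The choice is immaterial: since unit_sphere N `*` off_diag I is dense in
   unit_sphere N `*` closure (off_diag I), any two extensions agree there. *)
Definition growth_rate_ext (R : realType) (n : nat) (N : 'cV[R]_n -> R)
    (I : set R) (Phi : R -> R -> 'M[R]_n) : 'cV[R]_n * (R * R) -> R :=
  xget (fun=> 0) (continuous_extensions N I Phi).

Definition LP (R : realType) (n : nat) (N : 'cV[R]_n -> R) (I : set R) :
    set (R -> R -> 'M[R]_n) :=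
  [set Phi | is_linear_process N I Phi /\
    exists g, continuous_extensions N I Phi g].

Definition growth_rates (R : realType) (n : nat) (N : 'cV[R]_n -> R)
    (I : set R) (X : {vspace 'cV[R]_n}) (Phi : R -> R -> 'M[R]_n) : set R :=
  growth_rate_ext N I Phi @`
    (([set` X] `&` unit_sphere N) `*` closure (off_diag I)).

Definition lambda_low (R : realType) (n : nat) (N : 'cV[R]_n -> R)
    (I : set R) (X : {vspace 'cV[R]_n}) (Phi : R -> R -> 'M[R]_n) : \bar R :=
  if X == 0%VS then +oo%E else (minimum (growth_rates N I X Phi))%:E.

Definition lambda_up (R : realType) (n : nat) (N : 'cV[R]_n -> R)
    (I : set R) (X : {vspace 'cV[R]_n}) (Phi : R -> R -> 'M[R]_n) : \bar R :=
  if X == 0%VS then -oo%E else (maximum (growth_rates N I X Phi))%:E.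

Definition Gr (R : realType) (k n : nat) : set {vspace 'cV[R]_n} :=
  [set X | \dim X = k].
Arguments Gr : clear implicits.

(* On Gr(1, R^n) the exponents are finite, so that fine is harmless. *)
Definition dist_tilde (R : realType) (n : nat) (N : 'cV[R]_n -> R)
    (I : set R) (Phi Psi : R -> R -> 'M[R]_n) : R :=
  sup [set Num.max
         `|fine (lambda_low N I X Phi) - fine (lambda_low N I X Psi)|
         `|fine (lambda_up N I X Phi) - fine (lambda_up N I X Psi)|
      | X in Gr R 1 n].

Definition dist_LP (R : realType) (n : nat) (N : 'cV[R]_n -> R)
    (I : set R) (Phi Psi : R -> R -> 'M[R]_n) : R :=
  Num.max
    (sup [set sup [set N ((Phi t (minimum I) - Psi t (minimum I)) *m x)
                  | t in I]
         | x in unit_sphere N])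
    (dist_tilde N I Phi Psi).

(* Lipschitz continuity on A, with respect to the distance d and with constant
   L, of an extended-real valued f: either f is real valued and Lipschitz in
   the usual sense, or f is constantly +oo or constantly -oo. The second case
   is separate because the difference of two infinities is not 0 in \bar R. *)
Definition lipschitz_ereal (R : realType) (T : Type) (d : T -> T -> R)
    (L : R) (A : set T) (f : T -> \bar R) : Prop :=
  [\/ (forall p, A p -> f p \is a fin_num) /\
        (forall p q, A p -> A q -> `|fine (f p) - fine (f q)| <= L * d p q),
      (forall p, A p -> f p = +oo%E) |
      (forall p, A p -> f p = -oo%E)].

(* Main.v *)
Require Import Defs.
From HB Require Import structures.
From mathcomp Require Import all_boot all_order all_algebra.
From mathcomp Require Import all_classical all_reals all_analysis.

Set Implicit Arguments.
Unset Strict Implicit.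
Unset Printing Implicit Defensive.
Import Order.TTheory GRing.Theory Num.Theory.
Import numFieldNormedType.Exports.
Local Open Scope classical_set_scope.
Local Open Scope ring_scope.

(** The distance between two processes dominates the difference of their
    exponents on every line, because it is a supremum over lines; this needs
    the supremum to be taken over a bounded set. It remains to pass from lines
    to an arbitrary nonzero subspace X. The growth rates of a process along X
    are the union of its growth rates along the lines contained in X, so the
    lower exponent of X is the minimum of the lower exponents of these lines,
    and a minimum of functions that are 1-Lipschitz is 1-Lipschitz. In detail:
    the lower exponent of Psi on X is a growth rate of Psi along some line Y of
    X, hence at least the lower exponent of Psi on Y, hence at least the lower
    exponent of Phi on Y minus the distance, hence at least the lower exponent
    of Phi on X minus the distance (lambda_low_le). Upper exponents are treated
    alike (lambda_up_le), and exchanging Phi and Psi gives the absolute value.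

    All of this rests on the exponents being attained, and on all growth rates
    being bounded. Both follow from growth_rates_compact: growth rates are the
    image, under the continuous extension of the difference quotient, of the
    product of the unit sphere of X with the closure of the off-diagonal pairs.
    Compactness of the unit sphere of an arbitrary norm is obtained by comparing
    that norm with the maximum norm (unit_sphere_compact). *)

(** * Extrema of compact sets of reals *)

Lemma minimumP (R : realType) (A : set R) : compact A -> A !=set0 ->
  A (minimum A) /\ lbound A (minimum A).
Proof.
move=> cA A0.
have [c /set_mem Ac cmin] := @compact_EVT_min _ R idfun A A0 cA
  (continuous_subspaceT (fun x => @cvg_id _ (nbhs x))).
suff /(xgetI 0)[] : (A `&` lbound A) c by [].
by split=> // t At; apply: cmin; exact/mem_set.
Qed.

Lemma maximumP (R : realType) (A : set R) : compact A -> A !=set0 ->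
  A (maximum A) /\ ubound A (maximum A).
Proof.
move=> cA A0.
have [c /set_mem Ac cmax] := @compact_EVT_max _ R idfun A A0 cA
  (continuous_subspaceT (fun x => @cvg_id _ (nbhs x))).
suff /(xgetI 0)[] : (A `&` ubound A) c by [].
by split=> // t At; apply: cmax; exact/mem_set.
Qed.

(** * Finite-dimensional topology *)

Lemma mx_linear_continuous (R : realType) (m n : nat) (V : normedModType R)
  (f : {linear 'M[R]_(m, n) -> V}) : continuous f.
Proof.
have -> : f = (fun M => \sum_i \sum_j M i j *: f (delta_mx i j)) :> (_ -> _).
  apply/funext => M; rewrite {1}(matrix_sum_delta M) raddf_sum.
  apply: eq_bigr => i _; rewrite raddf_sum.
  by apply: eq_bigr => j _; exact: linearZ_LR.
move=> M; have FM : Filter (nbhs M) by exact: nbhs_filter.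
apply: (cvg_big _ FM) => [|i _]; first exact: add_continuous.
apply: (cvg_big _ FM) => [|j _]; first exact: add_continuous.
by apply: cvgZr_tmp; exact: coord_continuous.
Qed.

Lemma coord_le_mx_norm (R : realType) (m n : nat) (x : 'M[R]_(m, n)) i j :
  `|x i j| <= `|x|.
Proof. by rewrite [leRHS]/Num.norm/= mx_normrE (le_bigmax _ _ (i, j)). Qed.

(** Transposition carries the Heine-Borel property from row vectors to column
    vectors: it is continuous and preserves the maximum norm. *)
Lemma cV_bounded_closed_compact (R : realType) (n : nat) (A : set 'cV[R]_n) :
  bounded_set A -> closed A -> compact A.
Proof.
move=> bA cA.
have -> : A = trmx @` (trmx @^-1` A : set 'rV[R]_n).
  apply/seteqP; split=> [x Ax|_ [x Ax <-]//].
  by exists x^T; rewrite /= trmxK.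
apply: continuous_compact.
  by apply: continuous_subspaceT; exact: mx_linear_continuous.
apply: bounded_closed_compact.
  have [M [Mr MA]] := bA; exists M; split=> // y My x /= /(MA y My).
  apply: le_trans.
  rewrite [leLHS]/Num.norm /= mx_normrE; apply: bigmax_le => // -[i j] _ /=.
  by have := coord_le_mx_norm x^T j i; rewrite mxE.
apply: preimage_closed cA => x _; exact: mx_linear_continuous.
Qed.

(** A subspace is the kernel of the complement of a projection onto it, and
    linear maps are continuous. *)
Lemma vspace_closed (R : realType) (n : nat) (X : {vspace 'cV[R]_n}) :
  closed [set` X].
Proof.
have -> : [set` X] = (\1 - projv X)%VF @^-1` [set 0].
  apply/seteqP; split=> x /=; rewrite add_lfunE opp_lfunE id_lfunE.
    by move=> xX; rewrite projv_id ?subrr.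
  by move=> /subr0_eq ->; exact: memv_proj.
apply: preimage_closed => [x _|]; first exact: mx_linear_continuous.
exact/accessible_closed_set1/hausdorff_accessible/norm_hausdorff.
Qed.

(** * Arbitrary norms *)

Section norm.
Context (R : realType) (n : nat) (N : 'cV[R]_n -> R) (N_norm : is_norm N).

Lemma is_norm0 : N 0 = 0.
Proof. by rewrite -(scale0r 0) norm_homogeneous// normr0 mul0r. Qed.

Lemma is_normN x : N (- x) = N x.
Proof. by rewrite -scaleN1r norm_homogeneous// normrN1 mul1r. Qed.

Lemma is_norm_ge0 x : 0 <= N x.
Proof.
have := norm_triangle N_norm x (- x).
by rewrite subrr is_norm0 is_normN -mulr2n pmulrn_lge0.
Qed.

Lemma is_norm_le_mx_norm : exists C, forall x, N x <= C * `|x|.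
Proof.
exists (\sum_i \sum_j N (delta_mx i j)) => x.
have NS (J : finType) (F : J -> 'cV[R]_n) : N (\sum_j F j) <= \sum_j N (F j).
  elim/big_ind2 : _ => [|u a v b uv ab|//]; first by rewrite is_norm0.
  by rewrite (le_trans (norm_triangle N_norm _ _))// lerD.
rewrite {1}(matrix_sum_delta x) mulr_suml (le_trans (NS _ _))//.
apply: ler_sum => i _; rewrite mulr_suml (le_trans (NS _ _))//.
apply: ler_sum => j _; rewrite norm_homogeneous// mulrC.
rewrite ler_wpM2l ?is_norm_ge0//.
exact: coord_le_mx_norm.
Qed.

Lemma is_norm_continuous : continuous N.
Proof.
have [C NC] := is_norm_le_mx_norm; move=> x.
have Nsub y z : N y - N z <= N (y - z).
  by rewrite lerBlDr (le_trans _ (norm_triangle N_norm _ _))// subrK.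
have Nlip y : `|N x - N y| <= C * `|x - y|.
  rewrite ler_norml lerNl opprB (le_trans (Nsub x y) (NC _)) andbT.
  by rewrite distrC (le_trans (Nsub y x) (NC _)).
(* C may vanish, and is then not a divisor. *)
have C1 : 0 < `|C| + 1 by rewrite ltr_wpDl.
have Fx : Filter (nbhs x) by exact: nbhs_filter.
apply/cvgrPdist_lt => e e0; near=> y.
rewrite (le_lt_trans (Nlip y))// (@le_lt_trans _ _ ((`|C| + 1) * `|x - y|))//.
  by rewrite ler_wpM2r// (le_trans (ler_norm C))// lerDl.
rewrite mulrC -ltr_pdivlMr//; near: y.
by apply: cvgr_dist_lt => //; exact: divr_gt0.
Unshelve. all: by end_near. Qed.

(** N is continuous, so its unit sphere is closed. It is also bounded: by
    compactness and definiteness N has a positive minimum m on the sphere of the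
    maximum norm, hence the maximum norm is at most N / m. *)
Lemma unit_sphere_compact : compact (unit_sphere N).
Proof.
apply: cV_bounded_closed_compact; last first.
  apply: (@preimage_closed _ _ N [set 1]); last exact: closed_eq.
  by move=> x _; exact: is_norm_continuous.
pose A := [set x : 'cV[R]_n | `|x| = 1].
(* In dimension 0 the sphere A is empty and has no minimum of N. *)
have [A0|A0] := pselect (A !=set0); last first.
  exists 0; split=> // M M0 x Nx.
  have [->|x0] := eqVneq x 0; first by rewrite /= normr0 ltW.
  by case: A0; exists (`|x|^-1 *: x);
    rewrite /A/= normrZ normfV normr_id mulVf ?normr_eq0.
have cA : compact A.
  apply: cV_bounded_closed_compact.
    by exists 1; split=> // M M1 x /= ->; exact: ltW.
  apply: (@preimage_closed _ _ (@Num.norm _ 'cV[R]_n) [set 1]);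
    last exact: closed_eq.
  by move=> x _; exact: norm_continuous.
have [c /set_mem Ac cmin] :=
  compact_EVT_min A0 cA (continuous_subspaceT is_norm_continuous).
have Nc0 : 0 < N c.
  rewrite lt_neqAle is_norm_ge0 andbT eq_sym.
  apply/eqP => /(norm_definite N_norm) c0.
  have : `|0 : 'cV[R]_n| = 1 by rewrite -c0.
  by rewrite normr0 => /esym/eqP; rewrite oner_eq0.
exists (N c)^-1; split=> [|M cM x Nx]; first by rewrite num_real.
rewrite /= (le_trans _ (ltW cM))//.
have [->|x0] := eqVneq x 0; first by rewrite /= normr0 invr_ge0 ltW.
have xx0 : 0 < `|x| by rewrite normr_gt0.
have /cmin : `|x|^-1 *: x \in A.
  by apply/mem_set; rewrite /A/= normrZ normfV normr_id mulVf// gt_eqF.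
rewrite norm_homogeneous// Nx mulr1 normfV normr_id.
by move=> cx; rewrite -[leLHS]invrK lef_pV2 ?posrE ?invr_gt0.
Qed.

Lemma unit_sphere_vspace (X : {vspace 'cV[R]_n}) :
  X != 0%VS -> ([set` X] `&` unit_sphere N) !=set0.
Proof.
move=> X0; pose v := vpick X.
have Nv0 : N v != 0.
  apply: contra_neq X0 => /(norm_definite N_norm)/eqP.
  by rewrite vpick0 => /eqP.
exists ((N v)^-1 *: v); split=> /=; first by rewrite memvZ ?memv_pick.
rewrite /unit_sphere/= norm_homogeneous// ger0_norm ?mulVf//.
by rewrite invr_ge0 is_norm_ge0.
Qed.

(** * Growth rates of a process *)

Section process.
Context (I : set R) (I_compact : compact I) (I_lt : minimum I < maximum I).

(** The extrema of I are genuine, since I_lt excludes the empty set, for which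
    both default to 0; they are then two distinct points of I. *)
Lemma off_diag_nonempty : off_diag I !=set0.
Proof.
have I0 : I !=set0.
  apply/set0P/eqP => I0; move: I_lt.
  have x0 : xget 0 set0 = 0 :> R by apply: xgetPN => ? [].
  by rewrite /minimum /maximum I0 !set0I x0 ltxx.
have [Imin _] := minimumP I_compact I0.
have [Imax _] := maximumP I_compact I0.
by exists (minimum I, maximum I); split=> //=; rewrite lt_eqF.
Qed.

Lemma closure_off_diag_compact : compact (closure (off_diag I)).
Proof.
have cII := compact_setX I_compact I_compact.
apply: (subclosed_compact _ cII); first exact: closed_closure.
rewrite [X in _ `<=` X](closure_id _).1.
  by apply: closure_subset => -[t s] [].
exact: (compact_closed (@norm_hausdorff _ _) cII).
Qed.

Lemma growth_rate_ext_continuous Phi : LP N I Phi ->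
  {within unit_sphere N `*` closure (off_diag I),
    continuous (growth_rate_ext N I Phi)}.
Proof. by case=> _ /(xgetPex (fun=> 0))[]. Qed.

Lemma growth_rates_compact X Phi : LP N I Phi ->
  compact (growth_rates N I X Phi).
Proof.
move=> LPPhi; apply: continuous_compact.
  apply: continuous_subspaceW (growth_rate_ext_continuous LPPhi).
  by apply: setSX => // x [].
apply: compact_setX closure_off_diag_compact.
rewrite setIC; apply: compact_closedI unit_sphere_compact _.
exact: vspace_closed.
Qed.

Lemma growth_rates_nonempty X Phi : X != 0%VS -> growth_rates N I X Phi !=set0.
Proof.
move=> /unit_sphere_vspace[x Xx]; have [p Ip] := off_diag_nonempty.
apply: image_nonempty; exists (x, p); split=> //; exact: subset_closure.
Qed.

Lemma growth_rates_subset X Y Phi : (X <= Y)%VS ->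
  growth_rates N I X Phi `<=` growth_rates N I Y Phi.
Proof.
move=> /subvP XY; apply: image_subset => -[x p] [[Xx Sx] Kp].
by split=> //; split=> //=; exact: XY.
Qed.

(** A growth rate is observed along a single vector, so it belongs to the line
    spanned by it: this is what reduces subspaces to lines. *)
Lemma growth_rates_line X Phi a : growth_rates N I X Phi a ->
  exists Y, [/\ \dim Y = 1%N, (Y <= X)%VS & growth_rates N I Y Phi a].
Proof.
move=> [[x p] [[Xx Sx] Kp] <-]; exists <[x]>%VS.
rewrite dim_vline -memvE; split=> //; last first.
  by exists (x, p) => //; split=> //; split=> //=; exact: memv_line.
have [x0|//] := eqVneq x 0.
by move: Sx; rewrite /unit_sphere/= x0 is_norm0 => /esym/eqP; rewrite oner_eq0.
Qed.

(** * Exponents *)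

Lemma dim1_neq0 (Y : {vspace 'cV[R]_n}) : \dim Y = 1%N -> Y != 0%VS.
Proof. by move=> dY; rewrite -dimv_eq0 dY. Qed.

Lemma lambda_lowP X Phi : X != 0%VS -> LP N I Phi ->
  growth_rates N I X Phi (fine (lambda_low N I X Phi)) /\
  lbound (growth_rates N I X Phi) (fine (lambda_low N I X Phi)).
Proof.
move=> X0 LPPhi; rewrite /lambda_low (negbTE X0) /=.
by apply: minimumP; [exact: growth_rates_compact|exact: growth_rates_nonempty].
Qed.

Lemma lambda_upP X Phi : X != 0%VS -> LP N I Phi ->
  growth_rates N I X Phi (fine (lambda_up N I X Phi)) /\
  ubound (growth_rates N I X Phi) (fine (lambda_up N I X Phi)).
Proof.
move=> X0 LPPhi; rewrite /lambda_up (negbTE X0) /=.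
by apply: maximumP; [exact: growth_rates_compact|exact: growth_rates_nonempty].
Qed.

(** The growth rates of the whole space form a compact set, which contains the
    exponents of all nonzero subspaces. This uniform bound is what makes the
    supremum over lines in dist_tilde a genuine one. *)
Lemma lambda_bounded Phi : LP N I Phi -> exists M, forall Y, Y != 0%VS ->
  `|fine (lambda_low N I Y Phi)| <= M /\ `|fine (lambda_up N I Y Phi)| <= M.
Proof.
move=> LPPhi.
have [M [_ MP]] := compact_bounded (growth_rates_compact (X := fullv) LPPhi).
have YM Y a : growth_rates N I Y Phi a -> `|a| <= M + 1.
  move=> Ya; apply: (MP (M + 1)); first by rewrite ltrDl.
  exact: (growth_rates_subset (subvf Y) Ya).
exists (M + 1) => Y Y0.
by split; apply: (YM Y);
  [case: (lambda_lowP Y0 LPPhi)|case: (lambda_upP Y0 LPPhi)].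
Qed.

Lemma lambda_line_dist Phi Psi (Y : {vspace 'cV[R]_n}) :
  LP N I Phi -> LP N I Psi -> \dim Y = 1%N ->
  `|fine (lambda_low N I Y Phi) - fine (lambda_low N I Y Psi)|
    <= dist_LP N I Phi Psi /\
  `|fine (lambda_up N I Y Phi) - fine (lambda_up N I Y Psi)|
    <= dist_LP N I Phi Psi.
Proof.
move=> LPPhi LPPsi dY; apply/andP; rewrite -ge_max.
rewrite /dist_LP le_max; apply/orP; right.
apply: ub_le_sup; last by exists Y.
have [M MP] := lambda_bounded LPPhi; have [M' MP'] := lambda_bounded LPPsi.
exists (M + M') => _ [Z /dim1_neq0 Z0 <-].
have [? ?] := MP _ Z0; have [? ?] := MP' _ Z0.
by rewrite ge_max !(le_trans (ler_normB _ _))// lerD.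
Qed.

(** The line Y that attains the lower exponent of Psi on X serves as a test line
    for Phi, whose lower exponent on X is at most that on Y. The bound d on
    lines is symmetric in Phi and Psi, so that the roles can be exchanged. *)
Lemma lambda_low_le Phi Psi X d : LP N I Phi -> LP N I Psi -> X != 0%VS ->
  (forall Y, \dim Y = 1%N ->
    `|fine (lambda_low N I Y Phi) - fine (lambda_low N I Y Psi)| <= d) ->
  fine (lambda_low N I X Phi) - fine (lambda_low N I X Psi) <= d.
Proof.
move=> LPPhi LPPsi X0 dP.
have [/growth_rates_line[Y [dY YX Ya]] _] := lambda_lowP X0 LPPsi.
have Y0 := dim1_neq0 dY.
have [_ /(_ _ Ya) lowY] := lambda_lowP Y0 LPPsi.
have [/(growth_rates_subset YX) Xb _] := lambda_lowP Y0 LPPhi.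
have [_ /(_ _ Xb) lowX] := lambda_lowP X0 LPPhi.
exact: le_trans (lerB lowX lowY) (le_trans (ler_norm _) (dP Y dY)).
Qed.

(** For upper exponents the test line is one that attains the exponent of Phi,
    not of Psi, because monotonicity in the subspace goes the other way. *)
Lemma lambda_up_le Phi Psi X d : LP N I Phi -> LP N I Psi -> X != 0%VS ->
  (forall Y, \dim Y = 1%N ->
    `|fine (lambda_up N I Y Phi) - fine (lambda_up N I Y Psi)| <= d) ->
  fine (lambda_up N I X Phi) - fine (lambda_up N I X Psi) <= d.
Proof.
move=> LPPhi LPPsi X0 dP.
have [/growth_rates_line[Y [dY YX Ya]] _] := lambda_upP X0 LPPhi.
have Y0 := dim1_neq0 dY.
have [_ /(_ _ Ya) upY] := lambda_upP Y0 LPPhi.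
have [/(growth_rates_subset YX) Xb _] := lambda_upP Y0 LPPsi.
have [_ /(_ _ Xb) upX] := lambda_upP X0 LPPsi.
exact: le_trans (lerB upY upX) (le_trans (ler_norm _) (dP Y dY)).
Qed.

End process.
End norm.

Theorem corollary2p16 (R : realType) (n : nat) (n_ge1 : (1 <= n)%N)
    (N : 'cV[R]_n -> R) (N_norm : is_norm N)
    (I : set R) (I_compact : compact I) (I_lt : minimum I < maximum I)
    (X : {vspace 'cV[R]_n}) :
  lipschitz_ereal (dist_LP N I) 1 (LP N I) (lambda_low N I X) /\
  lipschitz_ereal (dist_LP N I) 1 (LP N I) (lambda_up N I X).
Proof.
have [X0|X0] := eqVneq X 0%VS.
  split; [constructor 2|constructor 3] => Phi _.
    by rewrite /lambda_low X0 eqxx.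
  by rewrite /lambda_up X0 eqxx.
have line := lambda_line_dist N_norm I_compact I_lt.
split; constructor 1; split.
- by move=> Phi _; rewrite /lambda_low (negbTE X0).
- move=> Phi Psi LPPhi LPPsi; rewrite mul1r ler_norml lerNl opprB.
  apply/andP; split.
    apply: (lambda_low_le N_norm I_compact I_lt) => // Y dY.
    by rewrite distrC; have [] := line _ _ _ LPPhi LPPsi dY.
  apply: (lambda_low_le N_norm I_compact I_lt) => // Y dY.
  by have [] := line _ _ _ LPPhi LPPsi dY.
- by move=> Phi _; rewrite /lambda_up (negbTE X0).
- move=> Phi Psi LPPhi LPPsi; rewrite mul1r ler_norml lerNl opprB.
  apply/andP; split.
    apply: (lambda_up_le N_norm I_compact I_lt) => // Y dY.
    by rewrite distrC; have [] := line _ _ _ LPPhi LPPsi dY.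
  apply: (lambda_up_le N_norm I_compact I_lt) => // Y dY.
  by have [] := line _ _ _ LPPhi LPPsi dY.
Qed.
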